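(* Let $\mathcal{A}=((V_i)_{1\le i\le n},E)$ be an $n$-player arena (with a possibly infinite vertex set $V$), let $T_1,\dots,T_n\subseteq V$ and let $\mathcal{G}=(\mathcal{A},(\mathsf{B\ddot{u}chi}(T_i))_{1\le i\le n})$ be the associated Büchi game. Let $\sigma'$ be a Nash equilibrium from a vertex $v_0$ in $\mathcal{G}$ such that no vertex occurs infinitely often in $\mathsf{Out}(\sigma',v_0)$. Then there exists a finite-memory Nash equilibrium $\sigma$ from $v_0$ in $\mathcal{G}$ such that $\mathsf{SatPl}(\mathsf{Out}(\sigma,v_0))=\mathsf{SatPl}(\mathsf{Out}(\sigma',v_0))$.
   Context: Arenas. An $n$-player arena ($n\ge 1$) is $\mathcal{A}=((V_i)_{1\le i\le n},E)$ where $V$ is a (possibly infinite) set of vertices, $(V_i)_{1\le i\le n}$ is a partition of $V$ (parts may be empty; $V_i$ is the set of vertices controlled by player $P_i$), $E\subseteq V\times V$, and every vertex has at least one $E$-successor. A play is an infinite sequence $v_0v_1\ldots$ with $(v_\ell,v_{\ell+1})\in E$ for all $\ell\in\mathbb{N}$; a history is a finite non-empty prefix of a play. Strategies. A strategy of $P_i$ is a function $\sigma_i$ mapping each history $h$ ending in $V_i$ to an $E$-successor of the last vertex of $h$. A strategy profile is a tuple $\sigma=(\sigma_i)_{1\le i\le n}$ with one strategy per player. A play $v_0v_1\ldots$ is consistent with $\sigma_i$ if $v_\ell\in V_i$ implies $v_{\ell+1}=\sigma_i(v_0\ldots v_\ell)$ for all $\ell$. $\mathsf{Out}(\sigma,v_0)$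 is the unique play from $v_0$ consistent with all strategies of $\sigma$. Finite memory. A Mealy machine of $P_i$ is $(M,m_{\mathsf{init}},\mathsf{up},\mathsf{nxt}_i)$ with $M$ a finite set, $m_{\mathsf{init}}\in M$, $\mathsf{up}\colon M\times V\to M$ and $\mathsf{nxt}_i\colon M\times V_i\to V$. Let $\widehat{\mathsf{up}}(\varepsilon)=m_{\mathsf{init}}$ and $\widehat{\mathsf{up}}(wv)=\mathsf{up}(\widehat{\mathsf{up}}(w),v)$ for $w\in V^*$, $v\in V$. The machine induces the strategy $\sigma_i(h'v)=\mathsf{nxt}_i(\widehat{\mathsf{up}}(h'),v)$ for every history $h'v$ ending in $v\in V_i$ (with $h'\in V^*$ possibly empty). A strategy is finite-memory if it is induced by a Mealy machine. A strategy profile is finite-memory if all its strategies are. Objectives and equilibria. $\mathsf{B\ddot{u}chi}(T)$ is the set of plays $v_0v_1\ldots$ with $v_\ell\in T$ for infinitely many $\ell$; the objective of $P_i$ in $\mathcal{G}$ is $\mathsf{B\ddot{u}chi}(T_i)$. $\mathsf{SatPl}(\pi)=\{i\mid \pi\in\mathsf{B\ddot{u}chi}(T_i)\}$. A strategy profile $\sigma$ is a Nash equilibrium from $v_0$ if no player whose objective is not satisfied by $\mathsf{Out}(\sigma,v_0)$ has a strategy such that, when this player alone replaces their strategy in $\sigma$ by it, the outcome from $v_0$ satisfies their objective. *)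

(* Defs.v *)
(* MathComp, with the classical layer of MathComp-Analysis. *)
From mathcomp Require Import all_boot.
From mathcomp Require Import boolp classical_sets functions cardinality.
Set Implicit Arguments.
Unset Strict Implicit.
Unset Printing Implicit Defensive.

Local Open Scope classical_set_scope.

(* The partition (V_i)_i, whose parts may be empty, is given by the map sending
   a vertex to the index of its part: V_i = [set v | owner v = i]. *)
Record arena (n : nat) (V : Type) := Arena {
  owner : V -> 'I_n;
  edge : V -> V -> Prop;
  edge_total : forall v, exists w, edge v w
}.

Section Games.
Variables (n : nat) (V : Type) (A : arena n V).

Record play := Play {
  play_at :> nat -> V;
  play_edge : forall l, edge A (play_at l) (play_at l.+1)
}.

Definition is_history (h : seq V) : Prop :=
  exists (pi : play) (l : nat), h = mkseq pi l.+1.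

(* Only the values on histories ending in V_i are meaningful; a strategy takes
   arbitrary values elsewhere, and no definition below reads these values. *)
Record strategy (i : 'I_n) := Strategy {
  strategy_fun :> seq V -> V;
  strategy_edge : forall h v, is_history (rcons h v) -> owner A v = i ->
    edge A v (strategy_fun (rcons h v))
}.

Definition profile := forall i : 'I_n, strategy i.

Definition consistent (i : 'I_n) (s : strategy i) (pi : play) : Prop :=
  forall l, owner A (pi l) = i -> pi l.+1 = s (mkseq pi l.+1).

Lemma path_is_history (f : nat -> V) (l : nat) :
  (forall k, k < l -> edge A (f k) (f k.+1)) -> is_history (mkseq f l.+1).
Proof.
move=> fE; have [s sE] := choice (edge_total A).
pose g k := iter (k - l) s (f (minn k l)).
have gE k : edge A (g k) (g k.+1).
  rewrite /g; case: (ltnP k l) => kl.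
    rewrite (eqP (ltnW kl : k - l == 0)) (eqP (kl : k.+1 - l == 0)) /=.
    by rewrite (minn_idPl kl); exact: fE.
  by rewrite (minn_idPr (leqW kl)) subSn /=.
exists (Play gE), l; apply/eq_in_map => k; rewrite mem_iota add0n ltnS => /= kl.
by rewrite /g (eqP (kl : k - l == 0)) (minn_idPl kl).
Qed.

(* The pair (h, v) such that rcons h v is the history with l edges from v0 in
   which every move is the one prescribed by s. *)
Fixpoint out_history (s : profile) (v0 : V) (l : nat) : seq V * V :=
  if l is k.+1 then
    let: (h, v) := out_history s v0 k in
    (rcons h v, s (owner A v) (rcons h v))
  else ([::], v0).

Definition out_at (s : profile) (v0 : V) (l : nat) : V := (out_history s v0 l).2.

Lemma out_historyE (s : profile) (v0 : V) (l : nat) :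
  (out_history s v0 l).1 = mkseq (out_at s v0) l.
Proof.
elim: l => [//|l IHl]; rewrite mkseqS -IHl /out_at /=.
by case: (out_history s v0 l).
Qed.

Lemma out_atS (s : profile) (v0 : V) (l : nat) :
  out_at s v0 l.+1 =
  s (owner A (out_at s v0 l)) (mkseq (out_at s v0) l.+1).
Proof.
rewrite mkseqS -out_historyE /out_at /=.
by case: (out_history s v0 l).
Qed.

Lemma out_edge (s : profile) (v0 : V) (l : nat) :
  edge A (out_at s v0 l) (out_at s v0 l.+1).
Proof.
elim/ltn_ind: l => l IHl; rewrite out_atS mkseqS.
apply: strategy_edge => //; rewrite -mkseqS.
exact: path_is_history.
Qed.

Definition Out (s : profile) (v0 : V) : play := Play (out_edge s v0).

Lemma Out_consistent (s : profile) (v0 : V) :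
  Out s v0 0 = v0 /\ forall i, consistent (s i) (Out s v0).
Proof. by split=> // i l <-; exact: out_atS. Qed.

Lemma Out_unique (s : profile) (v0 : V) (pi : play) :
  pi 0 = v0 -> (forall i, consistent (s i) pi) -> pi =1 Out s v0.
Proof.
move=> pi0 pis; elim/ltn_ind => -[//|l] IHl.
rewrite (pis (owner A (pi l)))// [RHS]out_atS IHl//; congr (s _ _).
by apply/eq_in_map => k; rewrite mem_iota => /IHl.
Qed.

(* The strategy determines mealy_nxt on V_i only. *)
Record mealy := Mealy {
  mealy_state : finType;
  mealy_init : mealy_state;
  mealy_up : mealy_state -> V -> mealy_state;
  mealy_nxt : mealy_state -> V -> V
}.

Definition mealy_uphat (m : mealy) (w : seq V) : mealy_state m :=
  foldl (@mealy_up m) (mealy_init m) w.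

Definition induces (m : mealy) (i : 'I_n) (s : strategy i) : Prop :=
  forall h v, is_history (rcons h v) -> owner A v = i ->
    s (rcons h v) = mealy_nxt (mealy_uphat m h) v.

Definition finite_memory (i : 'I_n) (s : strategy i) : Prop :=
  exists m : mealy, induces m s.

Definition finite_memory_profile (s : profile) : Prop :=
  forall i, finite_memory (s i).

Definition buchi (T : set V) : set play :=
  [set pi | infinite_set [set l | T (pi l)]].

Definition buchi_game (T : 'I_n -> set V) : 'I_n -> set play :=
  fun i => buchi (T i).

Definition sat_players (Obj : 'I_n -> set play) (pi : play) : set 'I_n :=
  [set i | Obj i pi].

(* dfwith s t is the profile s in which player i plays t instead of s i. *)
Definition nash_equilibrium (Obj : 'I_n -> set play) (s : profile) (v0 : V) :
    Prop :=
  forall i, ~ Obj i (Out s v0) ->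
    ~ exists t : strategy i, Obj i (Out (dfwith s t) v0).

Definition occurs_infinitely_often (v : V) (pi : play) : Prop :=
  infinite_set [set l | pi l = v].

End Games.

Arguments buchi {n V} A T _.
Arguments buchi_game {n V} A T _ _.

(* Main.v *)
Require Import Defs.
From mathcomp Require Import all_boot.
From mathcomp Require Import boolp classical_sets functions cardinality.
From mathcomp Require wochoice.

(* The outcome of s' is rerouted into a play pi satisfying the same objectives
   on which a finite colouring tells apart all occurrences of each vertex: as no
   vertex occurs infinitely often, the play splits into blocks such that each
   vertex meets at most two consecutive ones, and cycles inside a block are
   shortcut. The colour is then enough memory to follow pi. When a player leaves
   pi, the other players punish this player with a memoryless strategy: it
   exists on the complement of the region where the player can force T i
   infinitely often, and since s' is an equilibrium its outcome never enters
   that region for a losing player i. *)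

Set Implicit Arguments.
Unset Strict Implicit.
Unset Printing Implicit Defensive.

Local Open Scope classical_set_scope.

(** * Unbounded sets and extremal elements of natural numbers *)

Lemma infinite_nat_unbounded (P : set nat) :
  infinite_set P <-> forall N, exists2 m, N <= m & P m.
Proof.
split=> [Pinf N | Pub /finite_seqP[s Ps]].
  apply: contrapT => nP; apply: Pinf; apply: sub_finite_set (finite_II N).
  move=> m Pm /=.
  by rewrite ltnNge; apply/negP => Nm; apply: nP; exists m.
have [m lt_m] := Pub (\max_(k <- s) k).+1; rewrite Ps /= => ms.
by have := leq_ltn_trans (@leq_bigmax_seq _ _ xpredT id m ms isT) lt_m; rewrite ltnn.
Qed.

Lemma finite_nat_bounded (P : set nat) :
  ~ infinite_set P <-> exists N, forall m, N <= m -> ~ P m.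
Proof.
split=> [Pfin | [N PN] /infinite_nat_unbounded/(_ N)[m /PN]//].
apply: contrapT => nN; apply: Pfin; apply/infinite_nat_unbounded => N.
apply: contrapT => nm; apply: nN; exists N => m Nm Pm; apply: nm.
by exists m.
Qed.

Lemma ex_minimal_nat (P : nat -> Prop) :
  (exists l, P l) -> exists2 l, P l & forall k, k < l -> ~ P k.
Proof.
move=> [l]; elim/ltn_ind: l => l IH Pl.
have [[k [kl Pk]]|nk] := pselect (exists k, k < l /\ P k); first exact: (IH k).
by exists l => // k kl Pk; apply: nk; exists k.
Qed.

Lemma ex_maximal_nat (P : nat -> Prop) a b :
  a < b -> P a -> exists m, [/\ a <= m, m < b, P m &
    forall l, m < l -> l < b -> ~ P l].
Proof.
elim: b => // b IH; rewrite ltnS => ab Pa.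
have [Pb|nPb] := pselect (P b).
  by exists b; split=> // l bl; rewrite ltnS leqNgt bl.
have {}ab : a < b by rewrite ltn_neqAle ab andbT; apply/eqP => E; rewrite -E in nPb.
have [m [am mb Pm mP]] := IH ab Pa; exists m; split=> //; first exact: ltnW.
move=> l ml; rewrite ltnS leq_eqVlt => /orP[/eqP-> //|]; exact: mP.
Qed.

(** * Rerouting a sequence by shortcutting cycles *)

(* Cut f into blocks such that vertices of distant blocks are distinct, and
   shortcut all cycles inside a block: a vertex then occurs only in two
   consecutive blocks, and the parity of the block tells its (at most two)
   occurrences apart. Blocks start at visits to each T i in turn, and block
   starts are never skipped. *)
Lemma injective_rerouting (n : nat) (V : Type) (T : 'I_n -> set V)
    (f : nat -> V) :
    0 < n -> (forall v, ~ infinite_set [set l | f l = v]) ->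
  exists (g : nat -> nat) (b : nat -> bool),
  [/\ g 0 = 0,
      forall k, exists2 m, f m = f (g k) & g k.+1 = m.+1,
      forall k, k <= g k,
      forall k k', f (g k) = f (g k') -> b k = b k' -> k = k' &
      forall i, infinite_set [set l | T i (f l)] ->
                infinite_set [set k | T i (f (g k))]].
Proof.
move=> n_gt0 f_fin.
pose turn j : 'I_n := Ordinal (ltn_pmod j n_gt0).
have /choice[bd bdP] v : exists N, forall m, N <= m -> f m <> v.
  by have /finite_nat_bounded[N NP] := f_fin v; exists N.
pose inf i := infinite_set [set l | T i (f l)].
have /choice[nx nxP] (jp : nat * nat) : exists q, [/\ jp.2 < q,
    forall l m, l <= jp.2 -> q <= m -> f m <> f l &
    inf (turn jp.1) -> T (turn jp.1) (f q)].
  case: jp => j p /=.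
  (* From [N] on, no vertex seen up to position [p] occurs again. *)
  pose N := maxn p.+1 (\max_(l < p.+1) bd (f l)).
  have NP q : N <= q -> p < q /\ forall l m, l <= p -> q <= m -> f m <> f l.
    rewrite geq_max => /andP[-> bq]; split=> // l m lp qm.
    apply: bdP; apply: leq_trans qm; apply: leq_trans bq.
    exact: (@leq_bigmax _ (fun l : 'I_p.+1 => bd (f l)) (Ordinal (lp : l < p.+1))).
  have [infj|ninf] := pselect (inf (turn j)).
    have /infinite_nat_unbounded/(_ N) [q Nq Tq] := infj.
    by exists q; have [? ?] := NP _ Nq.
  by exists N; have [? ?] := NP _ (leqnn N).
pose P := fix P j := if j is k.+1 then nx (k, P k) else 0.
have P_lt j : P j < P j.+1 by have [] := nxP (j, P j).
have P_sep j l m : l <= P j -> P j.+1 <= m -> f m <> f l.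
  by have [_ sep _] := nxP (j, P j); exact: sep.
have P_T j : inf (turn j) -> T (turn j) (f (P j.+1)).
  by have [] := nxP (j, P j).
have P_le : {homo P : j k / j <= k}.
  by apply: homo_leq => //; [exact: leq_trans | move=> j; apply: ltnW].
have P_ge j : j <= P j.
  by elim: j => // j IH; apply: leq_ltn_trans IH (P_lt j).
have /choice[blk blkP] l : exists j, P j <= l < P j.+1.
  elim: l => [|l [j /andP[Pjl lPj]]]; first by exists 0; rewrite /= (P_lt 0).
  have [lt|ge] := ltnP l.+1 (P j.+1); first by exists j; rewrite lt ltnW.
  exists j.+1; rewrite ge /=; apply: leq_ltn_trans (P_lt _); exact: lPj.
have /choice[lst lstP] l : exists q, [/\ l <= q, q < P (blk l).+1,
    f q = f l & forall m, q < m -> m < P (blk l).+1 -> f m <> f l].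
  by apply: (@ex_maximal_nat (fun m => f m = f l)) => //; case/andP: (blkP l).
pose g := fix g k := if k is k1.+1 then (lst (g k1)).+1 else 0.
have g_lt k : g k < g k.+1 by rewrite /= ltnS; have [] := lstP (g k).
have g_lst k k' : k < k' -> lst (g k) < g k'.
  elim: k' => // k' IH; rewrite ltnS leq_eqVlt => /orP[/eqP->|/IH lt].
    exact: ltnSn.
  exact: ltn_trans lt (g_lt k').
have sep_blk l m : (blk l).+1 < blk m -> f m <> f l.
  move=> lt; apply: (@P_sep (blk l).+1); first by case/andP: (blkP l) => _ /ltnW.
  by case/andP: (blkP m) => + _; apply: leq_trans; apply: P_le.
(* Equal vertices lie in the same block or in adjacent ones, and adjacent blocks differ in
   parity. *)
have blk_eq l m : f l = f m -> odd (blk l) = odd (blk m) -> blk l = blk m.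
  have blk_leq l' m' : f l' = f m' -> odd (blk l') = odd (blk m') ->
      blk l' <= blk m'.
    move=> E O; rewrite leqNgt; apply/negP.
    rewrite leq_eqVlt => /orP[/eqP F|/sep_blk //].
    by move: O; rewrite -F /=; case: (odd _).
  by move=> E O; apply/eqP; rewrite eqn_leq !blk_leq.
have g_inj_lt k k' : k < k' -> f (g k) = f (g k') ->
    odd (blk (g k)) = odd (blk (g k')) -> False.
  move=> lt E O; have B := blk_eq _ _ E O.
  have [_ _ _ /(_ (g k') (g_lst _ _ lt))] := lstP (g k).
  by rewrite B; case/andP: (blkP (g k')) => _ /[swap]/[apply]; apply.
have le_g k : k <= g k by elim: k => // k IH; apply: leq_ltn_trans IH (g_lt k).
(* As [lst] stays inside its block, a step of [g] cannot jump over the next block start: the first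
   value of [g] that is at least [P j.+1] equals it. *)
have g_hit j : exists k, g k = P j.+1.
  have [[|k] ge_k lt_k] : exists2 k, P j.+1 <= g k &
      forall k', k' < k -> ~ P j.+1 <= g k'.
    by apply: ex_minimal_nat; exists (P j.+1).
    by move: ge_k; rewrite leqNgt (leq_ltn_trans _ (P_lt j)).
  exists k.+1; apply/eqP; rewrite eqn_leq ge_k andbT.
  have /negP := lt_k k (ltnSn k); rewrite -ltnNge => lt_gk.
  have [_ lt_lst _ _] := lstP (g k); apply: leq_trans lt_lst _; apply: (P_le).
  rewrite ltnS leqNgt; apply/negP => /P_le.
  by rewrite leqNgt (leq_ltn_trans _ lt_gk) //; case/andP: (blkP (g k)).
have g_mono : {homo g : k k' / k <= k'}.
  by apply: homo_leq => //; [exact: leq_trans | move=> k; apply: ltnW].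
exists g, (fun k => odd (blk (g k))); split=> //.
- by move=> k; exists (lst (g k)) => //; have [] := lstP (g k).
- move=> k k' E O; have [lt|lt|//] := ltngtP k k'.
    by have := g_inj_lt _ _ lt E O.
  by have := g_inj_lt _ _ lt (esym E) (esym O).
- move=> i infi; apply/infinite_nat_unbounded => N.
  (* Congruent to [i] modulo [n], and so large that [P j.+1] exceeds [g N], hence is attained by [g]
     only after [N]. *)
  pose j := g N * n + i.
  have turn_j : turn j = i.
    by apply: val_inj; rewrite /= modnMDl modn_small.
  have [k gk] := g_hit j; exists k.
    rewrite leqNgt; apply/negP => /ltnW/g_mono; rewrite gk leqNgt.
    rewrite (leq_ltn_trans _ (leq_ltn_trans (P_ge j) (P_lt j))) //.
    by apply: leq_trans (leq_addr _ _); rewrite leq_pmulr.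
  by change (T i (f (g k))); rewrite gk -{1}turn_j; apply: P_T; rewrite turn_j.
Qed.

(** * Uniform memoryless punishment *)

(* least A is the minimum of A for some well-order of I. *)
Lemma ex_coherent_choice (I : Type) : inhabited I -> exists least : set I -> I,
  (forall A, A !=set0 -> A (least A)) /\
  (forall A B, B `<=` A -> B (least A) -> least B = least A).
Proof.
elim/Peq: I => I [x0].
have [R woR] := wochoice.well_ordering_principle I.
have /choice[least leastP] (A : set I) : exists x, A !=set0 ->
    A x /\ forall y, A y -> R x y.
  have [A0|nA0] := pselect (A !=set0); last by exists x0.
  have [|x [[Ax xmin] _]] := woR [pred x | `[< A x >]].
    by case: A0 => x Ax; exists x; exact/asboolP.
  exists x => _; split=> [|y Ay]; first exact/asboolP.
  by apply: xmin; exact/asboolP.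
(* Antisymmetry comes from the uniqueness of the minimum of a pair. *)
have antiR x y : R x y -> R y x -> R x x -> R y y -> x = y.
  move=> Rxy Ryx Rxx Ryy; have [|z [_ zuniq]] := woR (pred2 x y).
    by exists x; rewrite inE eqxx.
  have <- : z = x.
    by apply: zuniq; split=> [|t]; rewrite !inE ?eqxx // => /orP[]/eqP->.
  by apply: zuniq; split=> [|t]; rewrite !inE ?eqxx ?orbT // => /orP[]/eqP->.
exists least; split=> [A /leastP[] //|A B BA BA0].
have B0 : B !=set0 by exists (least A).
have [LB minB] := leastP B B0.
have [LA minA] : A (least A) /\ forall y, A y -> R (least A) y.
  by apply: leastP; exists (least A); apply: BA.
by apply: antiR; [apply: minB | apply: minA; apply: BA | apply: minB | apply: minA].
Qed.

Section Punishment.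
Variables (n : nat) (V : Type) (A : arena n V) (i : 'I_n) (T : set V).

Definition punishing_path (tau : V -> V) (f : nat -> V) :=
  forall l, edge A (f l) (f l.+1) /\ (owner A (f l) <> i -> f l.+1 = tau (f l)).

(** The winning region of [tau] in the co-Büchi game of the coalition against player [i]. *)
Definition punished (tau : V -> V) (v : V) :=
  forall f, f 0 = v -> punishing_path tau f -> exists N, forall l, N <= l -> ~ T (f l).

Lemma punished_suffix (tau : V -> V) (f : nat -> V) (N : nat) :
    (forall l, N <= l -> edge A (f l) (f l.+1) /\
                        (owner A (f l) <> i -> f l.+1 = tau (f l))) ->
    punished tau (f N) ->
  exists M, forall l, M <= l -> ~ T (f l).
Proof.
move=> fP /(_ (fun l => f (N + l))); rewrite addn0 => /(_ erefl)[].
  by move=> l; rewrite addnS; apply: fP; exact: leq_addr.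
move=> M MP; exists (N + M) => l NMl.
rewrite -(subnKC (leq_trans (leq_addr M N) NMl)).
by apply: MP; rewrite leq_subRL ?(leq_trans _ NMl) // leq_addr.
Qed.

Lemma punished_next (tau : V -> V) (v w : V) :
  punished tau v -> edge A v w -> (owner A v <> i -> w = tau v) -> punished tau w.
Proof.
move=> Pv Evw vw f f0 fP.
pose f' l := if l is l1.+1 then f l1 else v.
have [||N NP] := Pv f'; first by [].
  by case=> [|l]; [rewrite /= f0 | exact: fP].
by exists N => l Nl; apply: (NP l.+1); exact: leqW.
Qed.

(* The set of vertices from which player i can force a visit to T followed by
   a move into X. *)
Inductive attractor (X : set V) : V -> Prop :=
| attractor_target v : T v ->
    (owner A v = i -> exists2 w, edge A v w & X w) ->
    (owner A v <> i -> forall w, edge A v w -> X w) -> attractor X v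
| attractor_own v w : owner A v = i -> edge A v w -> attractor X w ->
    attractor X v
| attractor_opponent v : owner A v <> i ->
    (forall w, edge A v w -> attractor X w) -> attractor X v.

Definition memoryless_strategy := {tau : V -> V | forall v, edge A v (tau v)}.

(* Memoryless strategies are merged by always following the least one that is
   still winning; along a play this index eventually stabilises. *)
Lemma uniform_punishment : exists tau : memoryless_strategy,
  forall (tau' : memoryless_strategy) v,
    punished (sval tau') v -> punished (sval tau) v.
Proof.
have [s sE] := choice (edge_total A).
have [least [least_in least_sub]] :=
  @ex_coherent_choice memoryless_strategy (inhabits (exist _ s sE)).
pose W v : set memoryless_strategy := [set tau | punished (sval tau) v].
have tauE v : edge A v (sval (least (W v)) v) by apply: (svalP (least (W v))).
exists (exist _ (fun v => sval (least (W v)) v) tauE) => tau' v tau'v f f0 fP /=.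
have W0 l : W (f l) !=set0.
  elim: l => [|l IH]; first by exists tau'; rewrite f0.
  exists (least (W (f l))); have [fE fl] := fP l.
  exact: punished_next (least_in _ IH) fE fl.
pose U : set memoryless_strategy := \bigcup_l W (f l).
have [N _ NU] : U (least U).
  by apply: least_in; have [t Wt] := W0 0; exists t; exists 0.
(* Where [least U] wins, it is the least winning strategy, so the path follows it and it still wins
   at the next vertex. *)
have stable l : N <= l -> W (f l) (least U) /\ least (W (f l)) = least U.
  have inW k : W (f k) (least U) -> least (W (f k)) = least U.
    by move=> Wk; apply: least_sub => // t Wt; exists k.
  elim: l => [|l IH]; first by rewrite leqn0 => /eqP <-; split=> //; apply: inW.
  rewrite leq_eqVlt => /orP[/eqP<-|/IH[Wl El]]; first by split=> //; apply: inW.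
  have Wl1 : W (f l.+1) (least U).
    by have [fE fl] := fP l; apply: punished_next Wl fE _; rewrite -El.
  by split=> //; apply: inW.
apply: (@punished_suffix (sval (least U)) f N) NU => l /stable[_ <-].
exact: fP.
Qed.

(* Outside the attractor to X, the opponents can avoid T until they leave X,
   that is, until they reach a vertex where they already win. *)
Lemma unpunished_attractor : exists2 tau : V -> V,
  (forall v, edge A v (tau v)) &
  forall v, ~ punished tau v -> attractor (fun w => ~ punished tau w) v.
Proof.
have [[tau tauE] /= tau_max] := uniform_punishment.
exists tau => // v0 nv0; set X := fun w => _; apply: contrapT => nattr0.
(* If no such successor existed, [v] would be in the attractor, by [attractor_target] if [T v] and
   by [attractor_opponent] otherwise. *)
have /choice[esc escP] v : exists w, edge A v w /\ (~ attractor X v ->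
    owner A v <> i -> if `[< T v >] then ~ X w else ~ attractor X w).
  have [[w [Evw wP]]|nw] := pselect (exists w, edge A v w /\
      if `[< T v >] then ~ X w else ~ attractor X w); first by exists w.
  exists (tau v); split=> // nattr nown; case: nattr.
  case: asboolP nw => [Tv|nTv] nw.
    apply: attractor_target => // _ w Evw; apply: contrapT => nX.
    by apply: nw; exists w.
  apply: attractor_opponent => // w Evw; apply: contrapT => nX.
  by apply: nw; exists w.
pose tau' v := if `[< punished tau v >] then tau v else esc v.
have tau'E v : edge A v (tau' v).
  by rewrite /tau'; case: ifP => // _; have [] := escP v.
(* By maximality of [tau], it is enough that [tau'] punishes from [v0]. *)
apply: nv0; apply: (tau_max (exist _ tau' tau'E)) => f f0 fP /=.
have [[N PN]|nP] := pselect (exists l, punished tau (f l)).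
  apply: (punished_suffix (N := N) _ PN) => l.
  have PN' k : N <= k -> punished tau (f k).
    elim: k => [|k IH]; first by rewrite leqn0 => /eqP<-.
    rewrite leq_eqVlt => /orP[/eqP<-//|/IH Pk].
    have [fE fk] := fP k; apply: (punished_next (Pk) fE).
    by move/fk ->; rewrite /= /tau' asboolT.
  by move=> /PN' Pl; have [fE fl] := fP l; split=> // /fl ->; rewrite /= /tau' asboolT.
have Xf l : X (f l) by move=> Pl; apply: nP; exists l.
(* The path stays in [X]. On a vertex of [T] outside the attractor, player [i] has no move into [X]
   and [esc] leaves [X], so [T] is never met. *)
have step l : ~ attractor X (f l) -> ~ T (f l) /\ ~ attractor X (f l.+1).
  move=> nattr; have [fE fl] := fP l.
  have [own|nown] := eqVneq (owner A (f l)) i.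
    split=> [Tl|attr]; apply: nattr; last exact: attractor_own own fE attr.
    by apply: attractor_target => // _; exists (f l.+1).
  move/eqP: nown => nown; have [_ /(_ nattr nown)] := escP (f l).
  have -> : esc (f l) = f l.+1 by rewrite (fl nown) /= /tau' asboolF //; exact: Xf.
  by case: asboolP => // _ /(_ (Xf _)).
have nattr l : ~ attractor X (f l) by elim: l => [|l /step[]//]; rewrite f0.
by exists 0 => l _; have [] := step l (nattr l).
Qed.

End Punishment.

(** * Histories, strategies and outcomes of deviations *)

Section Strategies.
Variables (n : nat) (V : Type) (A : arena n V).

Lemma is_history_rcons (h : seq V) (v w : V) :
  is_history A (rcons h v) -> edge A v w -> is_history A (rcons (rcons h v) w).
Proof.
move=> [pi [l]]; rewrite mkseqS => /rcons_inj[-> ->] Ew.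
have -> : rcons (rcons (mkseq pi l) (pi l)) w =
    mkseq (fun k => if k <= l then pi k else w) l.+2.
  rewrite mkseqS ltnn -mkseqS; congr rcons; apply/eq_in_map => k.
  by rewrite mem_iota add0n ltnS => /= ->.
apply: path_is_history => k lek /=; rewrite ltnS in lek; rewrite lek.
case: ltnP => [_|lk]; first exact: play_edge.
by rewrite (@anti_leq k l) ?lek.
Qed.

Lemma strategy_of_choice (i : 'I_n) (x0 : V) (c : seq V -> V -> V) :
    (forall h v, is_history A (rcons h v) -> owner A v = i ->
                 edge A v (c h v)) ->
  exists t : strategy A i, forall h v, t (rcons h v) = c h v.
Proof.
move=> cE; pose f h := if h is x :: h' then c (belast x h') (last x h') else x0.
have fE h v : f (rcons h v) = c h v.
  by case: h => //= x h; rewrite belast_rcons last_rcons.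
have fP h v : is_history A (rcons h v) -> owner A v = i ->
    edge A v (f (rcons h v)) by rewrite fE; exact: cE.
by exists (Strategy fP).
Qed.

Lemma Out_deviator (s : profile A) (i : 'I_n) (t : strategy A i) v0 l :
  owner A (Out (dfwith s t) v0 l) = i ->
  Out (dfwith s t) v0 l.+1 = t (mkseq (Out (dfwith s t) v0) l.+1).
Proof.
move=> own; have [_ /(_ i)/(_ l own)->] := Out_consistent (dfwith s t) v0.
by rewrite dfwith_in.
Qed.

Lemma Out_nondeviator (s : profile A) (i : 'I_n) (t : strategy A i) v0 l :
  owner A (Out (dfwith s t) v0 l) <> i ->
  Out (dfwith s t) v0 l.+1 =
    s (owner A (Out (dfwith s t) v0 l)) (mkseq (Out (dfwith s t) v0) l.+1).
Proof.
move=> /eqP; rewrite eq_sym => nown.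
have [_ /(_ _ l erefl)->] := Out_consistent (dfwith s t) v0.
by rewrite dfwith_out.
Qed.

End Strategies.

(** * Profitable deviations from a post-fixed point of the attractor *)

Section Deviation.
Variables (n : nat) (V : Type) (A : arena n V) (i : 'I_n) (T X : set V).
Variables (s : profile A) (v0 : V).
Hypothesis X_attr : forall v, X v -> attractor A i T X v.

Let allowed h v w :=
  edge A v w /\ (owner A v <> i -> w = s (owner A v) (rcons h v)).

(* Against the fixed strategies of the opponents, player i can after the
   history rcons h v reach T in k steps and then move into X. *)
Fixpoint reaches k h v := if k is k1.+1
  then exists2 w, allowed h v w & reaches k1 (rcons h v) w
  else T v /\ exists2 w, allowed h v w & X w.

Let progresses k h v w :=
  if k is k1.+1 then reaches k1 (rcons h v) w else T v /\ X w.

Lemma reachesP k h v :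
  reaches k h v -> exists2 w, allowed h v w & progresses k h v w.
Proof. by case: k => [[Tv [w]]|k [w]]; exists w. Qed.

(** With infinitely many opponent moves, membership in the attractor bounds no number of steps in
    advance. Fixing [s] leaves a single opponent move after each history, so induction yields a
    finite [k]. *)
Lemma attractor_reaches v : attractor A i T X v ->
  forall h, is_history A (rcons h v) -> exists k, reaches k h v.
Proof.
have opponent w h : owner A w <> i -> is_history A (rcons h w) ->
    allowed h w (s (owner A w) (rcons h w)).
  by move=> _ hh; split=> //; exact: strategy_edge.
elim=> {v} [v Tv own opp|v w own Evw _ IH|v nown _ IH] h hh.
- exists 0; split=> //; have [ownv|/eqP nown] := eqVneq (owner A v) i.
    by have [w Evw Xw] := own ownv; exists w.
  have mv := opponent _ _ nown hh; exists (s (owner A v) (rcons h v)) => //.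
  by apply: opp => //; case: mv.
- have [k kw] := IH (rcons h v) (is_history_rcons hh Evw).
  by exists k.+1, w.
- have mv := opponent _ _ nown hh.
  have [k kw] := IH _ mv.1 (rcons h v) (is_history_rcons hh mv.1).
  by exists k.+1; exists (s (owner A v) (rcons h v)).
Qed.

(** The deviation copies [s i] while no visit is reachable, then heads for [T]. Each visit is
    followed by a vertex of [X], from which the next visit is reachable. *)
Lemma profitable_deviation l0 : X (Out s v0 l0) ->
  exists t : strategy A i, buchi A T (Out (dfwith s t) v0).
Proof.
move=> Xl0; pose some_reach h v := exists k, reaches k h v.
(* Minimality of k makes the distance to T decrease along the play. *)
have /choice[c cP] (p : seq V * V) : exists w,
    (some_reach p.1 p.2 -> exists k, [/\ allowed p.1 p.2 w,
       progresses k p.1 p.2 w & forall k', reaches k' p.1 p.2 -> k <= k']) /\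
    (~ some_reach p.1 p.2 -> w = s i (rcons p.1 p.2)).
  case: p => h v /=; have [/ex_minimal_nat[k kP kmin]|nr] := pselect (some_reach h v).
    have [w aw pw] := reachesP kP; exists w; split=> [_|[]]; last by exists k.
    exists k; split=> // k' k'P; rewrite leqNgt; apply/negP => /kmin; exact.
  by exists (s i (rcons h v)).
have [h v hh own|t tE] := @strategy_of_choice _ _ A i v0 (fun h v => c (h, v)).
  have [/= r nr] := cP (h, v); have [/r[k [[]]]//|/nr->] := pselect (some_reach h v).
  exact: strategy_edge.
exists t; set rho := Out _ _.
have step l k : reaches k (mkseq rho l) (rho l) ->
    exists2 k', k' <= k & progresses k' (mkseq rho l) (rho l) (rho l.+1).
  move=> kP; have [own|/eqP nown] := eqVneq (owner A (rho l)) i.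
    have [/(_ (ex_intro _ k kP))[k' [_ pk' kmin]] _] := cP (mkseq rho l, rho l).
    by exists k'; [exact: (kmin k) | rewrite Out_deviator // mkseqS tE].
  have [w [_ /(_ nown) wE] pw] := reachesP kP; exists k => //.
  by rewrite Out_nondeviator // mkseqS -wE.
have visit l k : reaches k (mkseq rho l) (rho l) ->
    exists m, [/\ l <= m, T (rho m) & X (rho m.+1)].
  elim/ltn_ind: k l => k IH l /step[[_ [Tl Xl]|k' lt_k']]; first by exists l.
  rewrite /= -mkseqS => /(IH _ lt_k')[m [lm Tm Xm]].
  by exists m; split=> //; exact: ltnW.
have reach_X (pi : play A) l : X (pi l) -> some_reach (mkseq pi l) (pi l).
  move=> /X_attr/attractor_reaches; apply; rewrite -mkseqS.
  by exists pi, l.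
(* Up to the first such position [l1], the deviation has not yet changed the outcome. *)
have [l1 [k l1P] l1min] : exists2 l, some_reach (mkseq (Out s v0) l) (Out s v0 l) &
    forall k, k < l -> ~ some_reach (mkseq (Out s v0) k) (Out s v0 k).
  by apply: ex_minimal_nat; exists l0; apply: reach_X.
have agree l : l <= l1 -> rho l = Out s v0 l.
  elim/ltn_ind: l => -[//|l] IH ltl.
  have El : mkseq rho l.+1 = mkseq (Out s v0) l.+1.
    apply/eq_in_map => j; rewrite mem_iota add0n => /= jl.
    by apply: IH => //; apply: leq_trans ltl; exact: ltnW.
  have eqr := IH l (ltnSn l) (ltnW ltl).
  have [_ outP] := Out_consistent s v0.
  have [own|/eqP nown] := eqVneq (owner A (rho l)) i.
    rewrite Out_deviator // El mkseqS tE.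
    have [_ /= ->] := cP (mkseq (Out s v0) l, Out s v0 l); last exact: l1min.
    by rewrite -mkseqS; apply/esym/outP; rewrite -eqr.
  by rewrite Out_nondeviator // El; apply/esym/outP; rewrite eqr.
have later N : exists m, [/\ N <= m, T (rho m) & X (rho m.+1)].
  elim: N => [|N [m [Nm _ /reach_X[k' /visit[m' [mm' Tm' Xm']]]]]].
    have := l1P; have -> : mkseq (Out s v0) l1 = mkseq rho l1.
      apply/eq_in_map => j; rewrite mem_iota add0n => /= /ltnW jl.
      exact/esym/agree.
    by rewrite -agree // => /visit[m [_ Tm Xm]]; exists m.
  by exists m'; split=> //; apply: leq_ltn_trans Nm mm'.
by apply/infinite_nat_unbounded => N; have [m [Nm Tm _]] := later N; exists m.
Qed.

End Deviation.

(** * A finite-memory profile that follows a play and punishes deviators *)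

Section Realisation.
Variables (n : nat) (V : Type) (A : arena n V) (v0 : V).
Variables (pi : play A) (C : finType) (colour : nat -> C).
Variable (tau : 'I_n -> V -> V).
Hypothesis pi0 : pi 0 = v0.
Hypothesis colour_inj :
  forall k k', pi k = pi k' -> colour k = colour k' -> k = k'.
Hypothesis tauE : forall i v, edge A v (tau i v).

(* The state inl (a, j) expects a vertex of pi of colour a after a move of
   player j; in the state inr j the opponents of player j punish this player.
   A deviation to a vertex of the expected colour goes unnoticed: the machine
   then follows pi from another position. *)
Lemma finite_memory_realisation : exists s : profile A,
  [/\ finite_memory_profile s, pi =1 Out s v0 &
   forall i (t : strategy A i), let rho := Out (dfwith s t) v0 in
   (exists q : nat -> nat, [/\ q 0 = 0, forall l, rho l = pi (q l) &
      forall l, colour (q l.+1) = colour (q l).+1]) \/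
   (exists l k, [/\ rho l = pi k, owner A (rho l) = i &
      forall m, l < m -> owner A (rho m) <> i -> rho m.+1 = tau i (rho m)])].
Proof.
pose at_pos (a : C) (v : V) k := colour k = a /\ pi k = v.
have at_pos_uniq a v k k' : at_pos a v k -> at_pos a v k' -> k = k'.
  by move=> [c1 p1] [c2 p2]; apply: colour_inj; rewrite ?p1 ?c1.
have /choice[pos posP] (av : C * V) : exists k,
    (exists k', at_pos av.1 av.2 k') -> at_pos av.1 av.2 k.
  have [[k kP]|nk] := pselect (exists k', at_pos av.1 av.2 k'); first by exists k.
  by exists 0.
pose on a v := `[< exists k, at_pos a v k >].
have posE k : pos (colour k, pi k) = k.
  by apply: (at_pos_uniq (colour k) (pi k)) => //; apply: posP; exists k.
have onE k : on (colour k) (pi k) by apply/asboolP; exists k.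
pose up (st : C * 'I_n + 'I_n) v := match st with
  | inl (a, j) =>
      if on a v then inl (colour (pos (a, v)).+1, owner A v) else inr j
  | inr j => inr j
  end.
pose nxt (st : C * 'I_n + 'I_n) v := match st with
  | inl (a, j) => if on a v then pi (pos (a, v)).+1 else tau j v
  | inr j => tau j v
  end.
(* The player in the initial state is a placeholder: on plays from [v0], the first vertex has the
   expected colour. *)
pose m := @Mealy V (C * 'I_n + 'I_n)%type (inl (colour 0, owner A v0)) up nxt.
have nxtE st v : edge A v (nxt st v).
  case: st => [[a j]|j] /=; last exact: tauE.
  rewrite /on; case: asboolP => [/(posP (a, v))[_ pv]|_]; last exact: tauE.
  by rewrite -{1}[v]pv; exact: play_edge.
have strat i : exists t : strategy A i,
    forall h v, t (rcons h v) = nxt (mealy_uphat m h) v.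
  by apply: (strategy_of_choice v0) => h v _ _; exact: nxtE.
pose s : profile A := fun i => sval (cid (strat i)).
have sE i h v : s i (rcons h v) = nxt (mealy_uphat m h) v.
  by rewrite /s; case: cid.
pose st (rho : nat -> V) l := mealy_uphat m (mkseq rho l).
have stS rho l : st rho l.+1 = up (st rho l) (rho l).
  by rewrite /st mkseqS /mealy_uphat foldl_rcons.
have st_on rho l k j : st rho l = inl (colour k, j) -> rho l = pi k ->
    st rho l.+1 = inl (colour k.+1, owner A (rho l)) /\
    nxt (st rho l) (rho l) = pi k.+1.
  by rewrite stS => -> ->; rewrite /= onE posE.
exists s; split=> [i||i t rho].
- by exists m => h v _ _; exact: sE.
- apply: Out_unique => // i l own; rewrite mkseqS sE.
  suff [j stl] : exists j, st pi l = inl (colour l, j).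
    by have [_ ->] := st_on _ _ _ _ stl erefl.
  elim: l {own} => [|l [j stl]]; first by exists (owner A v0).
  by have [-> _] := st_on _ _ _ _ stl erefl; exists (owner A (pi l)).
pose on_track l k := exists2 j, st rho l = inl (colour k, j) & rho l = pi k.
have [/choice[q qP]|noff] := pselect (forall l, exists k, on_track l k).
  left; exists q; split=> [|l|l].
  - have [j [c0 _] rho0] := qP 0; apply: colour_inj; rewrite // -rho0.
    exact: esym pi0.
  - by have [] := qP l.
  - have [j1 stl rhol] := qP l; have [j2 + _] := qP l.+1.
    by have [-> _] := st_on _ _ _ _ stl rhol => -[].
have [[|l] nl ltl] : exists2 l, ~ (exists k, on_track l k) &
    forall k, k < l -> ~ ~ (exists k', on_track k k').
  apply: ex_minimal_nat; apply: contrapT => nl; apply: noff => l.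
  by apply: contrapT => nk; apply: nl; exists l.
- by case: nl; exists 0; exists (owner A v0).
have /contrapT[k [j stl rhol]] := ltl l (ltnSn l).
have [stl1 nxtl] := st_on _ _ _ _ stl rhol.
(* Any other player would have moved to [pi k.+1], staying on track. *)
have own : owner A (rho l) = i.
  apply: contrapT => nown; apply: nl; exists k.+1; exists (owner A (rho l)) => //.
  by rewrite Out_nondeviator // mkseqS sE.
have off : on (colour k.+1) (rho l.+1) = false.
  apply/asboolP => -[k' [ck' pk']]; apply: nl; exists k'.
  by exists (owner A (rho l)); rewrite ?ck'.
(* The state becomes [inr i] only after reading the vertex at [l.+1]; at [l.+1] itself, [nxt]
   already applies [tau i] because the vertex is off track. *)
have st_inr m' : st rho (l.+2 + m') = inr i.
  elim: m' => [|m' IH]; last by rewrite addnS stS IH.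
  by rewrite addn0 stS stl1 /= off own.
right; exists l, k; split=> // m' lm' nown.
rewrite Out_nondeviator // mkseqS sE -/(st rho m').
move: lm'; rewrite leq_eqVlt => /orP[/eqP<-|lm']; first by rewrite stl1 /= off own.
by rewrite -(subnKC lm') st_inr.
Qed.

End Realisation.

(** * Assembling the equilibrium *)

Theorem theorem45 (n : nat) (hn : 1 <= n) (V : Type) (A : arena n V)
    (T : 'I_n -> set V) (s' : profile A) (v0 : V)
    (hnash : nash_equilibrium (buchi_game A T) s' v0)
    (hinf : forall v : V, ~ occurs_infinitely_often v (Out s' v0)) :
  exists s : profile A,
    [/\ finite_memory_profile s,
        nash_equilibrium (buchi_game A T) s v0 &
        sat_players (buchi_game A T) (Out s v0) =
        sat_players (buchi_game A T) (Out s' v0)].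
Proof.
have [g [b [g0 g_next le_g g_inj g_inf]]] := injective_rerouting T hn hinf.
have g_edge k : edge A (Out s' v0 (g k)) (Out s' v0 (g k.+1)).
  by have [m <- ->] := g_next k; exact: play_edge.
pose pi : play A := Play g_edge.
have pi_sat i : buchi A (T i) pi <-> buchi A (T i) (Out s' v0).
  split=> [inf_pi|]; last exact: g_inf.
  apply: contrapT => /finite_nat_bounded[N NP].
  have /infinite_nat_unbounded/(_ N)[k Nk] := inf_pi.
  by apply: NP; apply: leq_trans (le_g k).
have /choice[tau tauP] i : exists tau, (forall v, edge A v (tau v)) /\
    forall v, ~ punished A i (T i) tau v ->
      attractor A i (T i) (fun w => ~ punished A i (T i) tau w) v.
  by have [tau tauE tauP] := unpunished_attractor A i (T i); exists tau.
(* [pi k] lies on the outcome of [s'] at position [g k]; were it not punished, a losing player [i]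
   could deviate profitably from [s']. *)
have pi_punished i k : ~ buchi A (T i) pi -> punished A i (T i) (tau i) (pi k).
  move=> /(contra_not (pi_sat i).2) losing; apply: contrapT => npun.
  case: (hnash i losing).
  exact: (profitable_deviation (tauP i).2 npun).
have /choice[bound boundP] i : exists N,
    ~ buchi A (T i) pi -> forall k, N <= k -> ~ T i (pi k).
  have [sat|/finite_nat_bounded[N NP]] := pselect (buchi A (T i) pi).
    by exists 0.
  by exists N => _; exact: NP.
pose N := \max_i bound i.
have pi_N i k : ~ buchi A (T i) pi -> N <= k -> ~ T i (pi k).
  by move=> /boundP lost Nk; apply: lost; apply: leq_trans Nk; apply: leq_bigmax.
(* The first N positions get distinct colours, so that unnoticed deviations
   cannot come back to the visits to T i of a losing player i. *)
pose colour k : 'I_N.+1 * bool := (inord (minn k N), b k).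
have colour_min k k' : colour k = colour k' -> minn k N = minn k' N.
  by case=> /(congr1 val); rewrite /= !inordK ?ltnS ?geq_minr.
have colour_inj k k' : pi k = pi k' -> colour k = colour k' -> k = k'.
  by move=> pik [_ bk]; exact: g_inj.
have pi0 : pi 0 = v0 by rewrite /= g0.
have [s [s_fin s_pi s_dev]] :=
  finite_memory_realisation pi0 colour_inj (fun i => (tauP i).1).
have s_sat i : buchi A (T i) (Out s v0) <-> buchi A (T i) pi.
  rewrite /buchi /=; have -> // :
    [set l | T i (out_at s v0 l)] = [set l | T i (pi l)].
  by apply/funext => l; congr (T i _); exact/esym/s_pi.
exists s; split=> // [i lost [t]|]; last first.
  by apply/seteqP; split=> i /=; [move=> /s_sat/pi_sat | move=> /pi_sat/s_sat].
have {}lost : ~ buchi A (T i) pi by move=> /s_sat.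
apply/finite_nat_bounded.
have [[q [q0 rho_q colour_q]]|[l [k [rho_l own punish]]]] := s_dev i t.
  (* The capped counter in the colour forces [q] to advance in step with [l] up to [N], and never to
     fall below [N] afterwards. *)
  have min_q l : minn l N <= q l.
    elim: l => [|l IH]; first by rewrite min0n.
    apply: leq_trans (geq_minl _ N); rewrite (colour_min _ _ (colour_q l)).
    rewrite leq_min geq_minr andbT.
    apply: leq_trans (_ : (minn l N).+1 <= _); last exact: IH.
    by rewrite -minnSS leq_min geq_minl leqW ?geq_minr.
  exists N => l Nl Tl; apply: (pi_N i (q l)) => //; last by rewrite -rho_q.
  by have := min_q l; rewrite (minn_idPr Nl).
apply: (punished_suffix (tau := tau i) (f := Out (dfwith s t) v0) (N := l.+1)).
  by move=> m lm; split; [exact: play_edge | exact: punish].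
(* The deviating move is made by player [i], so it cannot leave the punished region. *)
apply: (punished_next (v := pi k)); first exact: pi_punished.
  by rewrite -rho_l; exact: play_edge.
by rewrite -rho_l.
Qed.
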